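(* Let $m \geq 1$ and $n = 2^m$. Then the hypercube $Q_n$ can be decomposed into cycles $C_1, C_2, \dots, C_r$, each of length $2^m n$, where $r = 2^{n-1-m}$, such that (I) every $C_i$ contains $2^m$ edges $e_{i1}, e_{i2}, \dots, e_{i2^m}$ such that $C_i - \{e_{i1}, \dots, e_{i2^m}\}$ has exactly $2^m$ components, each of which is a path of length $n-1$; and (II) the set $M = \{e_{ij} : j = 1, \dots, 2^m;\ i = 1, \dots, r\}$ is a perfect matching of $Q_n$.
   Context: $Q_n$ is the $n$-dimensional hypercube (vertices: binary $n$-tuples; edges: pairs differing in exactly one coordinate). A decomposition into cycles means a partition of the edge set into edge sets of cycles. Lengths are numbers of edges. A perfect matching is a set of pairwise vertex-disjoint edges covering every vertex. *)

(* Defs.v *)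
From mathcomp Require Import all_boot.

Set Implicit Arguments.
Unset Strict Implicit.
Unset Printing Implicit Defensive.

(* Edges are represented by the two-element sets of their end vertices. *)
Record graph (T : finType) := Graph {
  verts : {set T};
  edges : {set {set T}};
  edgesP : [forall e in edges, (#|e| == 2) && (e \subset verts)]
}.

Section Graphs.
Variable T : finType.
Implicit Types (G : graph T) (F M : {set {set T}}) (A : {set T}).

Definition adjacent G : rel T := fun x y => [set x; y] \in edges G.

Fact delete_edges_subproof G F :
  [forall e in edges G :\: F, (#|e| == 2) && (e \subset verts G)].
Proof.
apply/forall_inP => e /setDP[eG _].
by have /forall_inP := edgesP G; apply.
Qed.

Definition delete_edges G F : graph T := Graph (delete_edges_subproof G F).

Fact induced_subproof G A :
  [forall e in [set e in edges G | e \subset A],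
     (#|e| == 2) && (e \subset verts G :&: A)].
Proof.
apply/forall_inP => e; rewrite inE => /andP[eG eA].
have /forall_inP/(_ e eG)/andP[-> eV] := edgesP G.
by rewrite subsetI eV eA.
Qed.

Definition induced G A : graph T := Graph (induced_subproof G A).

(* A component is given by its vertex set; [induced G] recovers the subgraph. *)
Definition components G : {set {set T}} :=
  equivalence_partition (connect (adjacent G)) (verts G).

Definition glength G : nat := #|edges G|.

Definition is_cycle G : Prop :=
  exists c : seq T,
    [/\ 2 < size c, uniq c, verts G = [set x in c]
      & edges G = [set [set x; next c x] | x in c]].

Definition is_path G : Prop :=
  exists p : seq T,
    [/\ 0 < size p, uniq p, verts G = [set x in p]
      & edges G = [set [set u.1; u.2] | u in zip p (behead p)]].

Definition cycle_decomposition G r (C : 'I_r -> graph T) : Prop :=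
  [/\ forall i, is_cycle (C i),
      injective (fun i => edges (C i))
    & partition [set edges (C i) | i : 'I_r] (edges G)].

Definition perfect_matching G M : Prop :=
  [/\ M \subset edges G, trivIset M & cover M = verts G].

End Graphs.

Definition cube_adj n : rel (n.-tuple bool) :=
  fun x y => #|[set i : 'I_n | tnth x i != tnth y i]| == 1.

Definition cube_edges n : {set {set n.-tuple bool}} :=
  [set [set u.1; u.2] | u : n.-tuple bool * n.-tuple bool & cube_adj u.1 u.2].

Fact hypercube_subproof n :
  [forall e in cube_edges n, (#|e| == 2) && (e \subset [set: n.-tuple bool])].
Proof.
apply/forall_inP => e /imsetP[[x y]]; rewrite inE /= => xy ->.
rewrite subsetT andbT cards2; case: (x =P y) xy => // ->.
rewrite /cube_adj; set A := [set i | _]; suff -> : A = set0 by rewrite cards0.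
by apply/setP => i; rewrite !inE eqxx.
Qed.

Definition hypercube n : graph (n.-tuple bool) := Graph (hypercube_subproof n).

(* Main.v *)
Require Import Defs.
From mathcomp Require Import all_boot zify.

(** By induction on m, passing from Q_n to Q_2n = Q_n x Q_n. Deleting the
    matching M from the cycles in Q_n leaves paths with n-1 edges, and every
    vertex is an end of exactly one of them. Two cycles C, C' of Q_n span a
    torus C x C'; keep from it only the copies of C and C' over the ends of the
    edges of M. These partial tori partition the edges of Q_2n. Each one is a
    2n x 2n grid on a torus whose lines alternate M-edges e and paths P, and it
    is to be cut into n cycles following the pattern (horizontal e, P, vertical
    e, P), the horizontal e's being the new matching. At every grid vertex this
    amounts to choosing between going straight and turning, the choices at the
    two ends of each P being opposite. A uniform choice gives 2n diagonal
    staircases of half the required length; reversing the choice at the corners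
    of the P-P squares formed by one path of C' and every second path of C
    merges them in pairs. A parity argument shows that the two visits at a grid
    vertex always belong to different cycles. *)

Set Implicit Arguments.
Unset Strict Implicit.
Unset Printing Implicit Defensive.

(** * Iterates and orders of permutations *)

Lemma iter_cancel (T : Type) (f g : T -> T) k :
  cancel f g -> cancel (iter k f) (iter k g).
Proof.
move=> fK; elim: k => [|k IHk] x //.
by rewrite [iter _ f _]iterS iterSr fK IHk.
Qed.

Lemma order_eq_iter (T : finType) (f : T -> T) (N : nat) (x : T) :
    injective f -> 0 < N -> iter N f x = x ->
    (forall k, 0 < k < N -> iter k f x <> x) -> order f x = N.
Proof.
move=> f_inj N_gt0 fNx f_neq; case: (ltngtP (order f x) N) => // [lt_oN|lt_No].
  by case: (f_neq (order f x)); rewrite ?iter_order // order_gt0.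
by have := findex_iter lt_No; rewrite fNx findex0 => N0; rewrite -N0 in N_gt0.
Qed.

Lemma order_iter_neq (T : finType) (f : T -> T) (x : T) k :
  0 < k < order f x -> iter k f x <> x.
Proof.
move=> /andP[k_gt0 lt_k] fkx; have := findex_iter lt_k.
by rewrite fkx findex0 => k0; rewrite -k0 in k_gt0.
Qed.

Lemma order_connect (T : finType) (f : T -> T) (x y : T) :
  injective f -> fconnect f x y -> order f x = order f y.
Proof.
move=> f_inj xy; apply: eq_card => z; rewrite !inE.
exact: (same_connect (fconnect_sym f_inj) xy).
Qed.

(** * Routings: a matching, the paths left after deleting it, and their cycles *)

Section Routing.

Variables (V : finType) (adj : rel V) (n : nat).

(* A representative of the cycle through [x]. *)
Definition strand (mate twin : V -> V) (pol : pred V) (x : V) : V :=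
  froot (twin \o mate) (if pol x then mate x else x).

(** An orbit of [twin \o mate] is traversed by these two maps only, so whatever both preserve
    depends on the strand alone. This is how cycles are told apart. *)
Lemma strand_invariant (X : eqType) (mate twin : V -> V) (pol : pred V)
    (g : V -> X) x y :
    injective (twin \o mate) ->
    (forall z, g (mate z) = g z) -> (forall z, g (twin z) = g z) ->
  strand mate twin pol x = strand mate twin pol y -> g x = g y.
Proof.
move=> turn_inj g_mate g_twin /eqP.
rewrite (root_connect (fconnect_sym turn_inj)) => xy.
have g_turn : invariant (twin \o mate) g =1 xpredT.
  by move=> z; apply/eqP; rewrite /= g_twin g_mate.
have := fconnect_invariant g_turn xy.
by do 2?case: ifP => _; rewrite ?g_mate.
Qed.

(* [mate] is the matching M. Deleting M from the cycles leaves paths on n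
   vertices; [trail x] enumerates the one that ends at [x] from there to its
   other end [twin x], so [mate] and [twin] alternate along each cycle. [pol]
   orients the cycles, and [hue] colors the paths alternately along each of
   them. *)
Record routing := Routing {
  mate : V -> V;
  twin : V -> V;
  pol : pred V;
  hue : pred V;
  trail : V -> nat -> V;
  mateK : involutive mate;
  twinK : involutive twin;
  pol_mate : forall x, pol (mate x) = ~~ pol x;
  pol_twin : forall x, pol (twin x) = ~~ pol x;
  hue_mate : forall x, hue (mate x) = ~~ hue x;
  hue_twin : forall x, hue (twin x) = hue x;
  order_turn : forall x, order (twin \o mate) x = n;
  adj_sym : symmetric adj;
  adj_mate : forall x, adj x (mate x);
  trail0 : forall x, trail x 0 = x;
  trail_twin : forall x r, r < n -> trail (twin x) r = trail x (n.-1 - r);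
  trail_adj : forall x r, r.+1 < n -> adj (trail x r) (trail x r.+1);
  trail_inj : forall x y r s,
    strand mate twin pol x = strand mate twin pol y -> r < n -> s < n ->
    trail x r = trail y s ->
    (y = x /\ s = r) \/ (y = twin x /\ s = n.-1 - r);
  trail_cover : forall u v, adj u v ->
    v = mate u \/
    exists x r, [/\ r.+1 < n, u = trail x r & v = trail x r.+1]
}.

Section Theory.

Variable R : routing.
Local Notation mu := (mate R).
Local Notation rho := (twin R).
Local Notation theta := (twin R \o mate R).
Local Notation theta' := (mate R \o twin R).
Local Notation p := (pol R).
Local Notation b := (hue R).
Local Notation cls := (strand (mate R) (twin R) (pol R)).

(* This holds for the two ends of exactly one path in each cycle. *)
Definition chosen (y : V) : bool :=
  let t := if p y then rho y else y in froot theta t == t.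

Lemma turnK : cancel theta theta'.
Proof. by move=> x /=; rewrite (twinK R) (mateK R). Qed.

Lemma turnVK : cancel theta' theta.
Proof. by move=> x /=; rewrite (mateK R) (twinK R). Qed.

Lemma turn_inj : injective theta.
Proof. exact: can_inj turnK. Qed.

Lemma pol_turn x : p (theta x) = p x.
Proof. by rewrite /= (pol_twin R) (pol_mate R) negbK. Qed.

Lemma pol_iter_turn k x : p (iter k theta x) = p x.
Proof. by elim: k => //= k IHk; rewrite (pol_twin R) (pol_mate R) negbK. Qed.

Lemma pol_iter_turnV k x : p (iter k theta' x) = p x.
Proof. by elim: k => //= k IHk; rewrite (pol_mate R) (pol_twin R) negbK. Qed.

Lemma hue_turn x : b (theta x) = ~~ b x.
Proof. by rewrite /= (hue_twin R) (hue_mate R). Qed.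

(** The hue changes at every turn, so no orbit of [theta] is a single point. *)
Lemma size_gt1 (x : V) : 1 < n.
Proof.
rewrite -(order_turn R x); have := order_gt0 theta x.
case def_o: (order _ x) => [|[|o]] // _.
have := iter_order turn_inj x; rewrite def_o => /(congr1 b).
by rewrite [iter _ _ _]/(theta x) hue_turn; case: (b x).
Qed.

Lemma iter_turn x : iter n theta x = x.
Proof. by rewrite -[in LHS](order_turn R x) (iter_order turn_inj). Qed.

Lemma iter_turnV x : iter n theta' x = x.
Proof. by rewrite -[in LHS](iter_turn x) (iter_cancel n turnK). Qed.

Lemma iter_turn_neq x k : 0 < k < n -> iter k theta x <> x.
Proof. by rewrite -(order_turn R x); apply: order_iter_neq. Qed.

Lemma iter_turnV_neq x k : 0 < k < n -> iter k theta' x <> x.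
Proof.
move=> k_n kx; apply: (iter_turn_neq k_n (x := x)).
by rewrite -{1}kx (iter_cancel k turnVK).
Qed.

(** [rho] reverses the direction of travel: it conjugates [theta] to its inverse. *)
Lemma twin_turn k x : rho (iter k theta x) = iter k theta' (rho x).
Proof. by elim: k x => //= k IHk x; rewrite -IHk !(twinK R). Qed.

Lemma chosen_twin y : chosen (rho y) = chosen y.
Proof.
by rewrite /chosen (pol_twin R); case: (p y); rewrite //= (twinK R).
Qed.

(** The root of the [theta] orbit of the negative end [t] marks the chosen path. A negative [y]
    reaches it by stepping back; for a positive [y = rho t], stepping back amounts to moving [t]
    forward, by [twin_turn]. *)
Lemma chosen_exists y : exists2 k, k < n & chosen (iter k theta' y).
Proof.
pose t := if p y then rho y else y; pose t0 := froot theta t.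
have t_t0 : fconnect theta t t0 by apply: connect_root.
have pt : p t = false.
  by rewrite /t; case: ifP => // py; rewrite (pol_twin R) py.
have pt0 : p t0 = false.
  rewrite -pt; apply/esym; apply: fconnect_invariant t_t0 => x.
  by apply/eqP; rewrite pol_turn.
have rt0 : froot theta t0 = t0.
  exact: (root_root (fconnect_sym turn_inj)).
case py : (p y).
  exists (findex theta t t0); first by rewrite -(order_turn R t) findex_max.
  have -> : y = rho t by rewrite /t py (twinK R).
  rewrite -twin_turn iter_findex // chosen_twin /chosen pt0.
  by rewrite rt0.
have t0_t : fconnect theta t0 t by rewrite (fconnect_sym turn_inj).
exists (findex theta t0 t); first by rewrite -(order_turn R t0) findex_max.
have -> : y = t by rewrite /t py.
rewrite -{2}(iter_findex t0_t) (iter_cancel _ turnK) /chosen pt0.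
by rewrite rt0.
Qed.

(** Two chosen iterates would lie over the unique root of their orbit, hence coincide, which fewer
    than n steps do not allow. *)
Lemma chosen_iterV y k : chosen y -> 0 < k < n -> ~~ chosen (iter k theta' y).
Proof.
move=> ch_y k_n; apply/negP => ch_ky.
move: ch_y ch_ky; rewrite /chosen pol_iter_turnV.
case: ifP => _ /eqP ry /eqP rky.
  apply: (iter_turn_neq k_n (x := rho y)).
  have rho_ky : rho (iter k theta' y) = iter k theta (rho y).
    by rewrite -{1}(twinK R y) -twin_turn (twinK R).
  rewrite -rho_ky -rky rho_ky -[in RHS]ry.
  apply/eqP; rewrite (root_connect (fconnect_sym turn_inj)).
  by rewrite (fconnect_sym turn_inj) fconnect_iter.
apply: (iter_turnV_neq k_n (x := y)).
rewrite -rky -[in RHS]ry.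
apply/eqP; rewrite (root_connect (fconnect_sym turn_inj)).
by rewrite -{2}[y](iter_cancel k turnVK) fconnect_iter.
Qed.

(** [mu y] is one [theta'] step from [rho y], the other end of the chosen path. *)
Lemma chosen_mate y : chosen y -> ~~ chosen (mu y).
Proof.
move=> ch_y; rewrite -{1}[y](twinK R).
apply: (@chosen_iterV (rho y) 1); first by rewrite chosen_twin.
exact: size_gt1.
Qed.

Lemma strand_mate x : cls (mu x) = cls x.
Proof.
by rewrite /strand (pol_mate R); case: (p x); rewrite //= (mateK R).
Qed.

Lemma strand_twin x : cls (rho x) = cls x.
Proof.
rewrite /strand (pol_twin R); apply/eqP.
rewrite (root_connect (fconnect_sym turn_inj)).
case: (p x) => /=; last first.
  rewrite -{2}[x]turnVK; exact: fconnect1.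
rewrite (fconnect_sym turn_inj) -{2}[x](mateK R).
exact: (fconnect1 theta).
Qed.

Lemma trail_end x : trail R x n.-1 = rho x.
Proof.
have n_gt1 := size_gt1 x.
by rewrite -[in RHS](trail0 R (rho x)) trail_twin ?subn0 //; lia.
Qed.

End Theory.

End Routing.

(** * Cartesian products of graphs *)

Definition prod_adj (V W : finType) (e : rel V) (f : rel W) : rel (V * W) :=
  fun z w => (z.1 == w.1) && f z.2 w.2 || e z.1 w.1 && (z.2 == w.2).

Lemma prod_adj_sym (V W : finType) (e : rel V) (f : rel W) :
  symmetric e -> symmetric f -> symmetric (prod_adj e f).
Proof.
move=> e_sym f_sym z w; rewrite /prod_adj e_sym f_sym.
by rewrite [w.1 == _]eq_sym [w.2 == _]eq_sym.
Qed.

Lemma iter_pred (T : Type) (f : T -> T) k x :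
  0 < k -> iter k f x = f (iter k.-1 f x).
Proof. by case: k. Qed.

(** * New matching and new paths in the square of a graph with a routing *)

Section Product.

Variables (V : finType) (adj : rel V) (n : nat) (R : routing adj n).
Implicit Types (x y u v : V) (z w : V * V).

Local Notation mu := (mate R).
Local Notation rho := (twin R).
Local Notation theta := (twin R \o mate R).
Local Notation theta' := (mate R \o twin R).
Local Notation p := (pol R).
Local Notation b := (hue R).
Local Notation cls := (strand (mate R) (twin R) (pol R)).

(* The new path from [z] starts along the second coordinate iff [vert z].
   Without the correction at the chosen paths each new cycle would close up
   after half of the required length; the correction merges these in pairs. *)
Definition vert z : bool := p z.1 (+) p z.2 (+) (b z.1 && chosen R z.2).
(** The old path with which the new path from [z] starts, copied into the coordinate that [vert]
    selects. *)
Definition seg z r : V * V :=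
  if vert z then (z.1, trail R z.2 r) else (trail R z.1 r, z.2).
Definition fwd z : V * V := if vert z then (z.1, rho z.2) else (rho z.1, z.2).
Definition bwd z : V * V := if vert z then (rho z.1, z.2) else (z.1, rho z.2).
Definition mid z : V * V := (z.1, mu z.2).
Definition pmate z : V * V := (mu z.1, z.2).
(** A new path consists of the segment from [z] to [fwd z], a matching edge in the second
    coordinate, and a segment traversed backwards; [bwd] finds the start of the latter. *)
Definition ptwin z : V * V := bwd (mid (fwd z)).
Definition ppol z : bool := p z.1 (+) p z.2.
Definition phue z : bool := b z.1.
(** The second half is read from the far end, so that reversal holds almost by definition. *)
Definition ptrail z r : V * V :=
  if r < n then seg z r else seg (ptwin z) ((n + n).-1 - r).

(** Only one polarity changes between the two ends of an old path. Together with [vert_twin2]: every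
    copy of an old path is the segment of exactly one of its ends, so [fwd] is invertible. *)
Lemma vert_twin1 x y : vert (rho x, y) = ~~ vert (x, y).
Proof.
rewrite /vert /= (pol_twin R) (hue_twin R).
by case: (p x) (p y) (_ && _) => [] [] [].
Qed.

Lemma vert_twin2 x y : vert (x, rho y) = ~~ vert (x, y).
Proof.
rewrite /vert /= (pol_twin R) chosen_twin.
by case: (p x) (p y) (_ && _) => [] [] [].
Qed.

Lemma fwdK : cancel fwd bwd.
Proof.
case=> x y; rewrite /fwd /=; case vxy: (vert _); rewrite /bwd /=.
  by rewrite vert_twin2 vxy /= (twinK R).
by rewrite vert_twin1 vxy /= (twinK R).
Qed.

Lemma bwdK : cancel bwd fwd.
Proof.
case=> x y; rewrite /bwd /=; case vxy: (vert _); rewrite /fwd /=.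
  by rewrite vert_twin1 vxy /= (twinK R).
by rewrite vert_twin2 vxy /= (twinK R).
Qed.

Lemma midK : involutive mid.
Proof. by case=> x y; rewrite /mid /= (mateK R). Qed.

Lemma pmateK : involutive pmate.
Proof. by case=> x y; rewrite /pmate /= (mateK R). Qed.

Lemma fwd_ptwin z : fwd (ptwin z) = mid (fwd z).
Proof. exact: bwdK. Qed.

Lemma ptwinK : involutive ptwin.
Proof. by move=> z; rewrite /ptwin bwdK midK fwdK. Qed.

Lemma ppol_mate z : ppol (pmate z) = ~~ ppol z.
Proof. by rewrite /ppol /= (pol_mate R) addNb. Qed.

Lemma ppol_fwd z : ppol (fwd z) = ~~ ppol z.
Proof.
by rewrite /ppol /fwd; case: ifP => _ /=; rewrite (pol_twin R) ?addNb ?addbN.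
Qed.

(** The sign changes three times: along each of the two segments and on the edge between them. *)
Lemma ppol_twin z : ppol (ptwin z) = ~~ ppol z.
Proof.
have := ppol_fwd (ptwin z); rewrite fwd_ptwin.
have -> : ppol (mid (fwd z)) = ppol z.
  have := ppol_fwd z; rewrite /ppol /= (pol_mate R) addbN => ->.
  by rewrite negbK.
by move->; rewrite negbK.
Qed.

Lemma phue_fwd z : phue (fwd z) = phue z.
Proof. by rewrite /phue /fwd; case: ifP => _ //=; rewrite (hue_twin R). Qed.

Lemma phue_mate z : phue (pmate z) = ~~ phue z.
Proof. exact: hue_mate. Qed.

Lemma phue_twin z : phue (ptwin z) = phue z.
Proof. by rewrite -phue_fwd fwd_ptwin; apply: phue_fwd. Qed.

Lemma prod_adj1 x x' y : adj x x' -> prod_adj adj adj (x, y) (x', y).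
Proof. by rewrite /prod_adj /= eqxx => ->; rewrite orbT. Qed.

Lemma prod_adj2 x y y' : adj y y' -> prod_adj adj adj (x, y) (x, y').
Proof. by rewrite /prod_adj /= eqxx => ->. Qed.

Lemma prod_adj_mate z : prod_adj adj adj z (pmate z).
Proof. by case: z => x y; apply/prod_adj1/adj_mate. Qed.

Lemma seg0 z : seg z 0 = z.
Proof. by case: z => x y; rewrite /seg /= !trail0 if_same. Qed.

Lemma seg_end z : seg z n.-1 = fwd z.
Proof. by rewrite /seg /fwd !trail_end. Qed.

Lemma seg_adj z r : r.+1 < n -> prod_adj adj adj (seg z r) (seg z r.+1).
Proof.
move=> lt_r; rewrite /seg; case: ifP => _.
  exact/prod_adj2/trail_adj.
exact/prod_adj1/trail_adj.
Qed.

Lemma ptrail0 z : ptrail z 0 = z.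
Proof. by rewrite /ptrail (ltnW (size_gt1 R z.1)) seg0. Qed.

Lemma ptrail_twin z r :
  r < n + n -> ptrail (ptwin z) r = ptrail z ((n + n).-1 - r).
Proof.
rewrite /ptrail ptwinK => lt_r; case: (ltnP r n) => [r_n|n_r].
  rewrite ifN; last by lia.
  by congr seg; lia.
by rewrite ifT //; lia.
Qed.

Lemma ptrail_adj z r :
  r.+1 < n + n -> prod_adj adj adj (ptrail z r) (ptrail z r.+1).
Proof.
move=> lt_r; have [r_n|[n_r|r_n]] : r.+1 < n \/ n < r.+1 \/ r.+1 = n by lia.
- by rewrite /ptrail !ifT ?seg_adj //; lia.
- rewrite /ptrail !ifN; try lia.
  have -> : (n + n).-1 - r = ((n + n).-1 - r.+1).+1 by lia.
  by rewrite (prod_adj_sym (adj_sym R) (adj_sym R)) seg_adj //; lia.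
(* The remaining step, from n - 1 to n, is the matching edge between the two segments. *)
rewrite /ptrail ifT ?ifN; try lia.
have -> : (n + n).-1 - r.+1 = n.-1 by lia.
have -> : r = n.-1 by lia.
rewrite !seg_end fwd_ptwin; case: (fwd z) => x y.
exact/prod_adj2/adj_mate.
Qed.

(* Invariant along each new cycle, but different at the two ends of each path,
   so that the two visits at a grid vertex are made by different cycles. *)
Definition tint z : bool := b z.1 (+) p z.1 (+) (b z.2 (+) p z.2).

Lemma tint_mate z : tint (pmate z) = tint z.
Proof.
by rewrite /tint /= (hue_mate R) (pol_mate R); case: (b _) (p z.1) => [] [].
Qed.

Lemma tint_mid z : tint (mid z) = tint z.
Proof.
rewrite /tint /= (hue_mate R) (pol_mate R).
by case: (b z.2) (p z.2) => [] [].
Qed.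

Lemma tint_fwd z : tint (fwd z) = ~~ tint z.
Proof.
rewrite /tint /fwd; case: ifP => _ /=; rewrite (hue_twin R) (pol_twin R).
  by rewrite !addbN.
by rewrite addbN addNb.
Qed.

Lemma tint_twin z : tint (ptwin z) = tint z.
Proof.
apply: negb_inj; rewrite -!tint_fwd fwd_ptwin; exact: tint_mid.
Qed.

(** Names the torus on whose grid [z] lies. *)
Definition pcoarse z := (cls z.1, cls z.2).

Lemma pcoarse_mate z : pcoarse (pmate z) = pcoarse z.
Proof. by rewrite /pcoarse /= strand_mate. Qed.

Lemma pcoarse_fwd z : pcoarse (fwd z) = pcoarse z.
Proof. by rewrite /pcoarse /fwd; case: ifP => _ /=; rewrite strand_twin. Qed.

Lemma pcoarse_twin z : pcoarse (ptwin z) = pcoarse z.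
Proof.
rewrite -pcoarse_fwd fwd_ptwin -[RHS]pcoarse_fwd.
by rewrite /pcoarse /= strand_mate.
Qed.

Lemma seg_inj z w r s :
    pcoarse z = pcoarse w -> tint z = tint w -> r < n -> s < n ->
  seg z r = seg w s -> w = z /\ s = r.
Proof.
(* A vertical and a horizontal segment can cross only at ends of both, so [x'] is [x] or [rho x],
   and [y'] is [y] or [rho y]. No change or two changes contradict the values of [vert]; a single
   change contradicts the equal tints. *)
have crossed x y x' y' i j : vert (x, y) -> ~~ vert (x', y') ->
    cls x = cls x' -> cls y = cls y' -> tint (x, y) = tint (x', y') ->
    i < n -> j < n -> x = trail R x' j -> trail R y i = y' -> False.
  move=> v1 v2 cx cy tt i_n j_n ex ey; have n_gt0 : 0 < n by lia.
  rewrite -(trail0 R x) in ex; rewrite -(trail0 R y') in ey.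
  have [[x'E _]|[x'E _]] := trail_inj cx n_gt0 j_n ex;
    have [[y'E _]|[y'E _]] := trail_inj cy i_n n_gt0 ey; subst x' y'.
  - by rewrite v1 in v2.
  - move: tt; rewrite /tint /= (hue_twin R) (pol_twin R).
    by case: (b x) (p x) (b y) (p y) => [] [] [] [].
  - move: tt; rewrite /tint /= (hue_twin R) (pol_twin R).
    by case: (b x) (p x) (b y) (p y) => [] [] [] [].
  by rewrite vert_twin1 vert_twin2 v1 in v2.
case: z w => x y [x' y'] [cx cy] tt r_n s_n; rewrite /seg /=.
case v1: (vert (x, y)); case v2: (vert (x', y')) => - [].
- move=> ex /(trail_inj cy r_n s_n) [[-> ->]|[ey _]]; first by rewrite ex.
  by move: v2; rewrite ey -ex vert_twin2 v1.
- by move=> ex ey; case: (@crossed x y x' y' r s); rewrite ?v1 ?v2.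
- move=> ex ey; case: (@crossed x' y' x y s r) => //; rewrite ?v1 ?v2 //.
move=> /(trail_inj cx r_n s_n) [[-> ->]|[ex _]] ey; first by rewrite ey.
by move: v2; rewrite ex -ey vert_twin1 v1.
Qed.

Lemma ptrail_inj_aux z w r s :
    pcoarse z = pcoarse w -> tint z = tint w -> r < n + n -> s < n + n ->
    ptrail z r = ptrail w s ->
  (w = z /\ s = r) \/ (w = ptwin z /\ s = (n + n).-1 - r).
Proof.
move=> czw tzw lt_r lt_s; rewrite /ptrail.
case: ifP => r_n; case: ifP => s_n.
- by move=> /seg_inj[] // -> ->; left.
- move=> /seg_inj[]; rewrite ?pcoarse_twin ?tint_twin //; first by lia.
  by move=> /(canRL ptwinK) -> ?; right; split=> //; lia.
- move=> /seg_inj[]; rewrite ?pcoarse_twin ?tint_twin //; first by lia.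
  by move=> -> ->; right.
move=> /seg_inj[]; rewrite ?pcoarse_twin ?tint_twin //; try lia.
by move=> /(can_inj ptwinK) -> ?; left; split=> //; lia.
Qed.

Lemma ptrail_cover z w : prod_adj adj adj z w ->
  w = pmate z \/
  exists t r, [/\ r.+1 < n + n, z = ptrail t r & w = ptrail t r.+1].
Proof.
have cover_seg t r : r.+1 < n ->
    exists t' r', [/\ r'.+1 < n + n, seg t r = ptrail t' r'
                    & seg t r.+1 = ptrail t' r'.+1].
  move=> lt_r; exists t, r; rewrite /ptrail; split; first by lia.
    by rewrite ifT //; lia.
  by rewrite ifT //; lia.
have cover_rev t r : r.+1 < n ->
    exists t' r', [/\ r'.+1 < n + n, seg t r.+1 = ptrail t' r'
                    & seg t r = ptrail t' r'.+1].
  move=> lt_r; exists (ptwin t), ((n + n).-1 - r.+1); rewrite /ptrail ptwinK.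
  split; first by lia.
    by rewrite ifN; [congr seg; lia|lia].
  by rewrite ifN; [congr seg; lia|lia].
case: z w => x y [x' y'] /orP[] /= /andP[].
  move=> /eqP <- /(trail_cover R) [->|[t [r [lt_r -> ->]]]]; right.
    (* A matching edge in the second coordinate is the middle edge of the new path from
       [bwd (x, y)]. *)
    exists (bwd (x, y)), n.-1; have n_gt1 := size_gt1 R x.
    rewrite /ptrail; split; first by lia.
      by rewrite ifT ?seg_end ?bwdK //; lia.
    rewrite ifN; last by lia.
    have -> : (n + n).-1 - n.-1.+1 = n.-1 by lia.
    by rewrite seg_end fwd_ptwin bwdK.
  case vt: (vert (x, t)).
    by have := cover_seg (x, t) r lt_r; rewrite /seg /= vt.
  (* Otherwise [vert] holds at the other end [rho t], whose segment contains the edge in the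
     opposite direction. *)
  have [|t' [r' []]] := cover_rev (x, rho t) (n.-1 - r.+1); first by lia.
  rewrite /seg vert_twin2 vt /= !trail_twin; try lia.
  have -> : n.-1 - (n.-1 - r.+1).+1 = r by lia.
  have -> : n.-1 - (n.-1 - r.+1) = r.+1 by lia.
  by exists t', r'.
move=> /[swap] /eqP <- /(trail_cover R) [->|[t [r [lt_r -> ->]]]].
  by left.
right; case vt: (vert (t, y)); last first.
  by have := cover_seg (t, y) r lt_r; rewrite /seg /= vt.
have [|t' [r' []]] := cover_rev (rho t, y) (n.-1 - r.+1); first by lia.
rewrite /seg vert_twin1 vt /= !trail_twin; try lia.
have -> : n.-1 - (n.-1 - r.+1).+1 = r by lia.
have -> : n.-1 - (n.-1 - r.+1) = r.+1 by lia.
by exists t', r'.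
Qed.


(** * Orbits of the turn map of the product *)

Local Notation pturn := (ptwin \o pmate).

(** With equal polarities, the uncorrected path from [pmate (x, y)] is vertical, then horizontal,
    which gives the diagonal step. The first two cases are corrections at its first and its second
    segment. *)
Lemma pturnE x y : p x = p y ->
  pturn (x, y) =
    if ~~ b x && chosen R y then (mu x, mu y)
    else if ~~ b x && chosen R (theta' y) then (mu x, rho (theta' y))
    else (theta x, theta' y).
Proof.
move=> pxy; rewrite /pturn /= /pmate /ptwin /fwd /vert /=.
rewrite (pol_mate R) (hue_mate R) pxy addNb addbb /= if_neg.
case: ifP => [/andP[/negPf bx sy]|nA] /=.
  rewrite /bwd /vert /= (pol_twin R) !(pol_mate R) (hue_twin R) (hue_mate R).
  by rewrite bx pxy (negPf (chosen_mate sy)) negbK addbN addbb /= (twinK R).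
rewrite /bwd /vert /= !(pol_mate R) (pol_twin R) (hue_mate R) pxy negbK.
by rewrite addNb addbb if_neg.
Qed.

(* The step of a new cycle away from the chosen paths. *)
Definition drift z : V * V := (theta z.1, theta' z.2).

Lemma iter_drift k z : iter k drift z = (iter k theta z.1, iter k theta' z.2).
Proof. by elim: k => [|k IHk]; [case: z|rewrite iterS IHk]. Qed.

Lemma drift_period z : iter n drift z = z.
Proof. by rewrite iter_drift iter_turn iter_turnV; case: z. Qed.

Lemma pturn_inj : injective pturn.
Proof. exact: inj_comp (can_inj ptwinK) (can_inj pmateK). Qed.

(** The orbit consists of two drift runs of length n. Within a run the first coordinate does not
    return to its start, and its polarity tells the runs apart. *)
Lemma order_pturn_loop z w :
    (forall k, k < n -> iter k pturn z = iter k drift z) ->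
    (forall k, k < n -> iter k pturn w = iter k drift w) ->
    iter n pturn z = w -> iter n pturn w = z -> p z.1 != p w.1 ->
  forall k, k < n -> order pturn (iter k drift z) = n + n.
Proof.
move=> z_k w_k z_w w_z p_zw k k_n; have n_gt1 := size_gt1 R z.1.
rewrite -z_k // -(order_connect pturn_inj (fconnect_iter _ _ _)).
apply: (order_eq_iter pturn_inj); first by lia.
  by rewrite iterD z_w.
move=> j /andP[j_gt0 j_lt] jz; case: (ltnP j n) => [j_n|n_j].
  apply: (@iter_turn_neq _ _ _ R z.1 j); first by rewrite j_gt0.
  by move: jz; rewrite z_k // iter_drift; case: (z) => x y [].
move: jz; rewrite -(subnK n_j) iterD z_w w_k; last by lia.
move=> /(congr1 (fun v : V * V => p v.1)); rewrite iter_drift pol_iter_turn.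
by move=> pwz; rewrite pwz eqxx in p_zw.
Qed.

Lemma drift_normal k z : p z.1 = p z.2 -> chosen R z.2 ->
    0 < k < n -> (k.+1 < n) || ~~ b z.1 ->
  pturn (iter k drift z) = iter k.+1 drift z.
Proof.
case: z => x y /= pxy sy k_n hk.
rewrite !iter_drift [LHS]pturnE ?pol_iter_turn ?pol_iter_turnV //.
rewrite (negPf (chosen_iterV sy k_n)) andbF.
suff -> : ~~ b (iter k theta x) && chosen R (theta' (iter k theta' y)) = false.
  by [].
case: (ltnP k.+1 n) hk => [k1_n _|n_k1 /= bx].
  by rewrite -iterS (negPf (chosen_iterV sy _)) ?andbF.
(* In the last step [theta'] does return to the chosen [y], but the hue of the first coordinate is
   then opposite to that of [x], hence true, and the correction is off. *)
have k1 : k.+1 = n by lia.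
by rewrite -hue_turn -!iterS k1 iter_turn (negPf bx).
Qed.

(** A drift orbit is diverted only next to such a vertex: on leaving it if the hue of its first
    coordinate is false, just before reaching it if the hue is true. *)
Definition anchor z : bool := (p z.1 == p z.2) && chosen R z.2.

(** Drift would close up after n steps, but [z] is sent to [drift w] for another anchor [w] of the
    same kind, and [w] to [drift z]: two drift orbits merge. *)
Lemma order_anchorA z : anchor z -> ~~ b z.1 ->
  forall k, k < n -> order pturn (iter k drift (drift z)) = n + n.
Proof.
have run w : anchor w -> ~~ b w.1 -> forall k, k < n ->
    iter k pturn (drift w) = iter k drift (drift w).
  move=> /andP[/eqP pw sw] bw; elim=> // k IHk k_n.
  rewrite iterS IHk ?(ltnW k_n) // -!iterSr.
  by rewrite drift_normal // ?bw ?orbT.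
have turn w : anchor w -> ~~ b w.1 ->
    iter n pturn (drift w) = drift (mu (rho (mu w.1)), rho w.2).
  move=> aw bw; have n_gt1 := size_gt1 R w.1.
  rewrite iter_pred ?run -?iterSr ?prednK ?drift_period //; try lia.
  case: w aw bw => x y /andP[/eqP /= pxy sy] bx.
  by rewrite [LHS]pturnE // bx sy /= /drift /= (mateK R) !(twinK R).
move=> az bz; set w := (mu (rho (mu z.1)), rho z.2).
have aw : anchor w.
  case/andP: az => /eqP pz sz; rewrite /anchor /= chosen_twin sz.
  by rewrite !(pol_mate R, pol_twin R) pz negbK eqxx.
have bw : ~~ b w.1 by rewrite /= (hue_mate R) (hue_twin R) (hue_mate R) negbK.
apply: (@order_pturn_loop _ (drift w)); try exact: run; try exact: turn.
  rewrite (turn _ aw bw) /= !(mateK R, twinK R); by case: (z).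
rewrite !pol_turn /=.
by rewrite !(pol_mate R, pol_twin R) negbK; case: (p _).
Qed.

(** The step that would return to [z] leads to [w] instead, an anchor of the same kind, whose run
    leads back to [z]. *)
Lemma order_anchorB z : anchor z -> b z.1 ->
  forall k, k < n -> order pturn (iter k drift z) = n + n.
Proof.
have run w : anchor w -> b w.1 -> forall k, k < n ->
    iter k pturn w = iter k drift w.
  move=> /andP[/eqP pw sw] bw; elim=> // k IHk k_n.
  rewrite iterS IHk ?(ltnW k_n) //; case: k {IHk} k_n => [|k] k_n.
    by case: w pw sw bw => x y /= pxy sy bx; rewrite [LHS]pturnE // bx.
  by apply: drift_normal; rewrite ?k_n ?(ltnW k_n).
have turn w : anchor w -> b w.1 -> iter n pturn w = (rho w.1, rho w.2).
  move=> aw bw; have n_gt1 := size_gt1 R w.1.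
  rewrite iter_pred ?run //; try lia.
  case: w aw bw => x y /andP[/eqP /= pxy sy] bx.
  rewrite iter_drift [LHS]pturnE ?pol_iter_turn ?pol_iter_turnV //.
  rewrite -hue_turn -!iterS prednK ?iter_turn ?iter_turnV ?bx /=; last by lia.
  rewrite sy (negPf (chosen_iterV sy _)); last by lia.
  congr (_, _).
  rewrite -(twinK R (mu _)) -[rho (mu _)]/(theta _) -iterS prednK ?iter_turn //.
  by lia.
move=> az bz; set w := (rho z.1, rho z.2).
have aw : anchor w.
  case/andP: az => /eqP pz sz; rewrite /anchor /= chosen_twin sz.
  by rewrite !(pol_twin R) pz eqxx.
have bw : b w.1 by rewrite /= (hue_twin R).
apply: (@order_pturn_loop _ w); try exact: run; try exact: turn.
  by rewrite turn //= !(twinK R); case: (z).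
by rewrite /= (pol_twin R); case: (p _).
Qed.

Lemma order_pturn z : order pturn z = n + n.
Proof.
(* [pmate] conjugates [pturn] to its inverse and exchanges equal with different polarities, so
   orders need computing only for equal ones. *)
wlog pz : z / p z.1 = p z.2.
  case: (p z.1 =P p z.2) => [pz|pz] ih; first exact: ih.
  have n_gt1 := size_gt1 R z.1.
  have o_mz : order pturn (pmate z) = n + n.
    by apply: ih; rewrite /= (pol_mate R); case: (p z.1) (p z.2) pz => [] [].
  have pturnK : cancel pturn (pmate \o ptwin).
    by move=> w /=; rewrite ptwinK pmateK.
  have mate_iter k w :
      iter k pturn (pmate w) = pmate (iter k (pmate \o ptwin) w).
    by elim: k => //= k ->; rewrite !pmateK.
  have turn_z k w : iter k pturn w = w <-> iter k (pmate \o ptwin) w = w.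
    split=> [e|e]; first by rewrite -[in LHS]e (iter_cancel k pturnK).
    rewrite -[in LHS]e; apply: iter_cancel => v /=; by rewrite pmateK ptwinK.
  have iterE k : iter k pturn z = z <-> iter k pturn (pmate z) = pmate z.
    by rewrite mate_iter turn_z; split=> [->|/(can_inj pmateK)].
  apply: (order_eq_iter pturn_inj); first by lia.
    by apply/iterE; rewrite -o_mz iter_order //; apply: pturn_inj.
  by move=> k k_n /iterE; apply: order_iter_neq; rewrite o_mz.
(* The drift orbit of [z] contains an anchor [a], and [z] lies on the run from [a], or from
   [drift a] when the hue of [a.1] is false. *)
have [k k_n sk] := chosen_exists R z.2.
pose a := iter k drift z; have n_gt1 := size_gt1 R z.1.
have aa : anchor a.
  by rewrite /anchor /a iter_drift /= sk pol_iter_turn pol_iter_turnV pz eqxx.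
case ba: (b a.1); last first.
  have -> : z = iter (n - k).-1 drift (drift a).
    rewrite -iterSr prednK /a -?iterD ?subnK ?drift_period //; lia.
  by apply: order_anchorA; rewrite ?ba //; lia.
case: (posnP k) => [k0|k_gt0].
  by have := order_anchorB aa ba (ltnW n_gt1); rewrite /a k0.
have -> : z = iter (n - k) drift a.
  by rewrite /a -iterD subnK ?drift_period // ltnW.
by apply: order_anchorB => //; lia.
Qed.

(** The torus and the tint are preserved by [pmate] and [ptwin], so equal strands agree in both. *)
Lemma ptrail_inj z w r s :
    strand pmate ptwin ppol z = strand pmate ptwin ppol w ->
    r < n + n -> s < n + n -> ptrail z r = ptrail w s ->
  (w = z /\ s = r) \/ (w = ptwin z /\ s = (n + n).-1 - r).
Proof.
move=> zw r_n s_n; have inv X g := @strand_invariant _ X _ _ _ g _ _ pturn_inj.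
apply: ptrail_inj_aux => //; apply: inv zw;
  [exact: pcoarse_mate|exact: pcoarse_twin|exact: tint_mate|exact: tint_twin].
Qed.

Definition prod_routing : routing (prod_adj adj adj) (n + n) :=
  Routing pmateK ptwinK ppol_mate ppol_twin phue_mate phue_twin order_pturn
    (prod_adj_sym (adj_sym R) (adj_sym R)) prod_adj_mate
    ptrail0 ptrail_twin ptrail_adj ptrail_inj ptrail_cover.

End Product.

(** * Transport of a routing along a graph isomorphism *)

Section Transport.

Variables (V W : finType) (e : rel V) (e' : rel W) (n : nat).
Variables (f : V -> W) (g : W -> V) (R : routing e n).
Hypotheses (fK : cancel f g) (gK : cancel g f).
Hypothesis f_adj : forall x y, e' (f x) (f y) = e x y.

Let mu w := f (mate R (g w)).
Let rho w := f (twin R (g w)).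
Let p w := pol R (g w).
Let theta := twin R \o mate R.

Let iter_rho_mu k w : iter k (rho \o mu) w = f (iter k theta (g w)).
Proof. by elim: k => [|k IHk]; rewrite ?gK //= {}IHk /rho /mu !fK. Qed.

Let rho_mu_inj : injective (rho \o mu).
Proof.
move=> w1 w2; rewrite /= /rho /mu !fK => /(can_inj fK)/(turn_inj (R := R)).
exact: (can_inj gK).
Qed.

Let e'E w1 w2 : e' w1 w2 = e (g w1) (g w2).
Proof. by rewrite -f_adj !gK. Qed.

Definition transport_routing : routing e' n.
Proof.
apply: (@Routing _ e' n mu rho p (fun w => hue R (g w))
          (fun w r => f (trail R (g w) r))).
- by move=> w; rewrite /mu fK mateK gK.
- by move=> w; rewrite /rho fK twinK gK.
- by move=> w; rewrite /p /mu fK pol_mate.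
- by move=> w; rewrite /p /rho fK pol_twin.
- by move=> w; rewrite /mu fK hue_mate.
- by move=> w; rewrite /rho fK hue_twin.
- move=> w; apply: (order_eq_iter rho_mu_inj).
  + exact: ltnW (size_gt1 R (g w)).
  + by rewrite iter_rho_mu iter_turn gK.
  + by move=> k k_n; rewrite iter_rho_mu => /(canRL fK); apply: iter_turn_neq.
- by move=> w1 w2; rewrite !e'E (adj_sym R).
- by move=> w; rewrite e'E fK adj_mate.
- by move=> w; rewrite trail0 gK.
- by move=> w r r_n; rewrite /rho fK trail_twin.
- by move=> w r r_n; rewrite f_adj trail_adj.
- move=> w1 w2 r s /eqP.
  (* Roots depend on the enumeration of the type, so [f] need not carry roots to roots; only
     connectedness is carried over. *)
  rewrite (root_connect (fconnect_sym rho_mu_inj)) => /iter_findex.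
  rewrite iter_rho_mu; set k := findex _ _ _.
  have tl w : (if p w then mu w else w)
      = f (if p w then mate R (g w) else g w) by case: ifP; rewrite ?gK.
  rewrite !tl fK => /(can_inj fK) w12 r_n s_n /(can_inj fK) /trail_inj [] //.
    rewrite /strand -[pol R (g w2)]/(p w2) -w12; apply/eqP.
    by rewrite (root_connect (fconnect_sym (turn_inj (R := R)))) fconnect_iter.
  + by move=> [/(can_inj gK) -> ->]; left.
  + by move=> [g12 ->]; right; rewrite -[w2]gK g12.
move=> u v; rewrite e'E => /(trail_cover R) [v_u|[x [r [r_n u_x v_x]]]].
  by left; rewrite -[v]gK v_u.
right; exists (f x), r; rewrite fK; split=> //.
  by rewrite -u_x gK.
by rewrite -v_x gK.
Qed.

End Transport.

(** * The hypercube of dimension 2n as a product *)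

Lemma cube_adjE n (x y : n.-tuple bool) :
  cube_adj x y = (\sum_(i < n) (tnth x i != tnth y i) == 1).
Proof.
rewrite /cube_adj -sum1dep_card big_mkcond; congr (_ == 1).
Qed.

Lemma sum_diff_eq0 n (x y : n.-tuple bool) :
  (\sum_(i < n) (tnth x i != tnth y i) == 0) = (x == y).
Proof.
rewrite sum_nat_eq0; apply/forall_inP/eqP => [xy|-> i _]; last by rewrite eqxx.
by apply: eq_from_tnth => i; have := xy i isT; rewrite eqb0 negbK => /eqP.
Qed.

Definition cat_pair n (z : n.-tuple bool * n.-tuple bool) :
    (n + n).-tuple bool :=
  [tuple match split i with inl j => tnth z.1 j | inr j => tnth z.2 j end
    | i < n + n].

Definition split_pair n (x : (n + n).-tuple bool) :
    n.-tuple bool * n.-tuple bool :=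
  ([tuple tnth x (lshift n i) | i < n], [tuple tnth x (rshift n i) | i < n]).

Lemma cat_pairK n : cancel (@cat_pair n) (@split_pair n).
Proof.
case=> x y; congr pair; apply: eq_from_tnth => i; rewrite !tnth_mktuple.
  by rewrite -[lshift n i]/(unsplit (inl i)) unsplitK.
by rewrite -[rshift n i]/(unsplit (inr i)) unsplitK.
Qed.

Lemma split_pairK n : cancel (@split_pair n) (@cat_pair n).
Proof.
move=> x; apply: eq_from_tnth => i; rewrite tnth_mktuple -[in RHS](splitK i).
by case: (split i) => j; rewrite tnth_mktuple.
Qed.

(** The Hamming distances of the two halves add up, and two natural numbers have sum 1 iff one is 0
    and the other 1. *)
Lemma cat_pair_adj n (z w : n.-tuple bool * n.-tuple bool) :
  cube_adj (cat_pair z) (cat_pair w) = prod_adj (@cube_adj n) (@cube_adj n) z w.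
Proof.
rewrite /prod_adj !cube_adjE big_split_ord /=.
under eq_bigr => i _ do
  rewrite !tnth_mktuple -[lshift n i]/(unsplit (inl i)) unsplitK.
under [X in _ + X]eq_bigr => i _ do
  rewrite !tnth_mktuple -[rshift n i]/(unsplit (inr i)) unsplitK.
rewrite -!sum_diff_eq0.
by case: (\sum_(i < n) _) (\sum_(i < n) _) => [|[|a]] [|[|c]].
Qed.

(** * Base case and induction for the hypercubes *)

Definition flip1 (x : 1.-tuple bool) : 1.-tuple bool := [tuple ~~ thead x].

Lemma thead_flip1 x : thead (flip1 x) = ~~ thead x.
Proof. by []. Qed.

Lemma thead_inj : injective (@thead 0 bool).
Proof. by move=> x y xy; apply: eq_from_tnth => i; rewrite ord1. Qed.

Lemma flip1K : involutive flip1.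
Proof. by move=> x; apply: thead_inj; rewrite !thead_flip1 negbK. Qed.

Lemma cube_adj1 (x y : 1.-tuple bool) : cube_adj x y = (y == flip1 x).
Proof.
rewrite cube_adjE big_ord1 -!/(thead _) -(inj_eq thead_inj) thead_flip1.
by case: (thead x) (thead y) => [] [].
Qed.

Lemma cube_adj_sym n : symmetric (@cube_adj n).
Proof.
by move=> x y; rewrite !cube_adjE; under eq_bigr do rewrite eq_sym.
Qed.

(** A single cycle of length 4: [mu] flips the first bit, and each path is one edge flipping the
    second. The parity of a vertex serves as [pol], its first bit as [hue]. *)
Definition square_routing : routing (prod_adj (@cube_adj 1) (@cube_adj 1)) 2.
Proof.
pose mu (z : 1.-tuple bool * 1.-tuple bool) := (flip1 z.1, z.2).
pose rho (z : 1.-tuple bool * 1.-tuple bool) := (z.1, flip1 z.2).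
have muK : involutive mu by case=> x y; rewrite /mu /= flip1K.
have rhoK : involutive rho by case=> x y; rewrite /rho /= flip1K.
apply: (@Routing _ _ 2 mu rho (fun z => thead z.1 (+) thead z.2)
          (fun z => thead z.1) (fun z r => if r == 0 then z else rho z)) => //.
- by move=> z; rewrite /= thead_flip1 addNb.
- by move=> z; rewrite /= thead_flip1 addbN.
- move=> z; apply: order_eq_iter => //.
  + exact: inj_comp (can_inj rhoK) (can_inj muK).
  + by case: z => x y; rewrite /= /mu /rho /= !flip1K.
  + case=> [|[|k]] // _ /(congr1 (fun z => thead z.1)).
    by rewrite /= thead_flip1; case: (thead z.1).
- exact: prod_adj_sym (@cube_adj_sym 1) (@cube_adj_sym 1).
- by move=> z; rewrite /prod_adj /= !cube_adj1 !eqxx orbT.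
- by move=> z [|[|r]] //= _; rewrite rhoK.
- by case=> x y [|r] // _; rewrite /prod_adj /= !cube_adj1 !eqxx.
- move=> z w [|[|r]] [|[|s]] // _ _ _ /=; first by left.
  + by move=> ->; right; rewrite rhoK.
  + by move=> <-; right.
  + by move=> /(can_inj rhoK) ->; left.
case=> x y [x' y']; rewrite /prod_adj /= => /orP[] /andP[].
  by move=> /eqP <-; rewrite cube_adj1 => /eqP ->; right; exists (x, y), 0.
by rewrite cube_adj1 => /eqP -> /eqP <-; left.
Qed.

Lemma cube_routing m : inhabited (routing (@cube_adj (2 ^ m.+1)) (2 ^ m.+1)).
Proof.
elim: m => [|m [R]].
  by constructor; apply: transport_routing square_routing (@cat_pairK 1)
       (@split_pairK 1) (@cat_pair_adj 1).
rewrite [2 ^ m.+2]expnS mul2n -addnn; constructor.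
exact: transport_routing (prod_routing R) (@cat_pairK _) (@split_pairK _)
  (@cat_pair_adj _).
Qed.

(** * Two-element sets and sequences given by functions *)

Lemma set2_eq (T : finType) (a b c d : T) :
  [set a; b] = [set c; d] -> (a = c /\ b = d) \/ (a = d /\ b = c).
Proof.
move=> E.
have /set2P[ac|ad] : a \in [set c; d] by rewrite -E set21.
  subst c; left; split=> //.
  have /set2P[ba|] // : b \in [set a; d] by rewrite -E set22.
  by have : d \in [set a; b] by [rewrite E set22]; rewrite ba => /set2P[].
subst d; right; split=> //.
have /set2P[|ba] // : b \in [set c; a] by rewrite -E set22.
by have : c \in [set a; b] by [rewrite E set21]; rewrite ba => /set2P[].
Qed.

Lemma next_mkseq (T : eqType) (g : nat -> T) N q :
  uniq (mkseq g N) -> q < N ->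
  next (mkseq g N) (g q) = g (if q.+1 == N then 0 else q.+1).
Proof.
case: N => // N g_uniq q_N; rewrite next_nth map_f ?mem_iota //.
have index_q : index (g q) (mkseq g N.+1) = q.
  by rewrite -{1}(nth_mkseq (g 0) g q_N) index_uniq ?size_mkseq.
rewrite {1}/mkseq [iota 0 N.+1]/= [map g (_ :: _)]/= index_q eqSS.
(* At the last position [nth] runs off the tail, and its default [g 0] closes the cycle. *)
case: eqVneq => [->|qN]; first by rewrite nth_default ?size_map ?size_iota.
by rewrite (nth_map 0) ?nth_iota ?size_iota //; lia.
Qed.

Lemma zip_behead_mkseq (T : Type) (g : nat -> T) n :
  zip (mkseq g n) (behead (mkseq g n)) = mkseq (fun r => (g r, g r.+1)) n.-1.
Proof.
case: n => // n; rewrite /mkseq /=; move: 0 => a.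
by elim: n a => [|n IHn] a //=; rewrite IHn.
Qed.

(** * Directed edges (darts) of a regular graph with a routing *)

Section Darts.

Variables (V : finType) (adj : rel V) (n : nat) (R : routing adj n).
Hypothesis adj_irr : irreflexive adj.
Hypothesis adj_deg : forall u, #|[set v | adj u v]| = n.

Local Notation mu := (mate R).
Local Notation rho := (twin R).
Local Notation theta := (twin R \o mate R).
Local Notation p := (pol R).
Local Notation cls := (strand (mate R) (twin R) (pol R)).

(** The successor on the cycle: from the last vertex [rho z] of a path it crosses the matching edge.
    Thus pairs [z], [r] with r < n index matching edges and path edges alike. *)
Definition step z r : V := if r.+1 == n then mu (rho z) else trail R z r.+1.
Definition edge z r : {set V} := [set trail R z r; step z r].

Lemma trail_last z r : r.+1 == n -> trail R z r = rho z.
Proof. by move=> r_n; have -> : r = n.-1 by [lia]; apply: trail_end. Qed.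

Lemma step_adj z r : r < n -> adj (trail R z r) (step z r).
Proof.
move=> r_n; rewrite /step; case: ifP => r1_n.
  by rewrite trail_last // adj_mate.
by apply: trail_adj; lia.
Qed.

Lemma dart_onto u v :
  adj u v -> exists z r, [/\ r < n, u = trail R z r & v = step z r].
Proof.
move=> /(trail_cover R)[->|[z [r [r_n -> ->]]]].
  have n_gt1 := size_gt1 R u; have n1 : n.-1.+1 == n by lia.
  exists (rho u), n.-1; rewrite /step n1 trail_last ?twinK //; split=> //; lia.
by exists z, r; rewrite /step ltn_eqF //; split=> //; lia.
Qed.

(** Reversal exchanges the polarities, so the darts with [p z] will represent each edge in just one
    direction. *)
Lemma dart_rev z r : r < n ->
  exists z' r', [/\ r' < n, p z' = ~~ p z,
                    trail R z' r' = step z r & step z' r' = trail R z r].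
Proof.
move=> r_n; have n_gt1 := size_gt1 R z; rewrite {1}/step; case: ifP => r1_n.
  exists (rho (mu (rho z))), n.-1; have n1 : n.-1.+1 == n by lia.
  rewrite /step n1 !trail_last // !twinK mateK !(pol_twin R, pol_mate R).
  by split; rewrite ?negbK //; lia.
exists (rho z), (n.-1 - r.+1); rewrite pol_twin trail_twin; last by lia.
rewrite /step ifN; last by lia.
rewrite trail_twin; last by lia.
by split=> //; [lia|congr trail; lia|congr trail; lia].
Qed.

(* Each of the [n * #|V|] darts is covered by one of equally many pairs. *)
Lemma dart_inj z r z' r' : r < n -> r' < n ->
  trail R z r = trail R z' r' -> step z r = step z' r' -> z = z' /\ r = r'.
Proof.
move=> r_n r'_n e1 e2.
pose F (u : V * 'I_n) := (trail R u.1 u.2, step u.1 u.2).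
pose D := [set d : V * V | adj d.1 d.2].
have D_sub : D \subset F @: setT.
  apply/subsetP => -[u v]; rewrite inE => /dart_onto[y [s [s_n /= -> ->]]].
  by apply/imsetP; exists (y, Ordinal s_n).
have cardD : #|D| = #|V| * n.
  rewrite -sum1_card (eq_bigl (fun d => xpredT d.1 && adj d.1 d.2)); last first.
    by move=> d; rewrite inE.
  rewrite -(pair_big_dep xpredT adj (fun _ _ => 1)) /=.
  under eq_bigr => u _ do rewrite sum1dep_card adj_deg.
  by rewrite sum_nat_const.
have /imset_injP F_inj : #|F @: setT| == #|[set: V * 'I_n]|.
  rewrite eqn_leq leq_imset_card cardsT card_prod card_ord -cardD.
  exact: subset_leq_card.
have := F_inj (z, Ordinal r_n) (z', Ordinal r'_n) (in_setT _) (in_setT _).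
by rewrite /F /= e1 e2 => /(_ erefl) [-> ->].
Qed.

Lemma edge_inj z r z' r' : p z -> p z' -> r < n -> r' < n ->
  edge z r = edge z' r' -> z = z' /\ r = r'.
Proof.
move=> pz pz' r_n r'_n /set2_eq[[]|[e1 e2]]; first exact: dart_inj.
have [y [s [s_n py ty sy]]] := dart_rev z' r'_n.
have [zy _] : z = y /\ r = s by apply: dart_inj; rewrite ?ty ?sy.
by move: py; rewrite -zy pz pz'.
Qed.

Lemma edge_onto u v :
  adj u v -> exists z r, [/\ p z, r < n & [set u; v] = edge z r].
Proof.
move=> /dart_onto[z [r [r_n -> ->]]].
case pz: (p z); first by exists z, r.
have [y [s [s_n py ty sy]]] := dart_rev z r_n.
by exists y, s; rewrite py pz /edge ty sy setUC.
Qed.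

Lemma card_edge z r : r < n -> #|edge z r| = 2.
Proof.
move=> r_n; rewrite cards2; case: eqP => // e.
by have := step_adj z r_n; rewrite -e adj_irr.
Qed.

End Darts.

(** * The cycles of a routing *)

Section Loops.

Variables (V : finType) (adj : rel V) (n : nat) (R : routing adj n).
Hypothesis adj_irr : irreflexive adj.

Local Notation mu := (mate R).
Local Notation rho := (twin R).
Local Notation theta := (twin R \o mate R).
Local Notation p := (pol R).
Local Notation cls := (strand (mate R) (twin R) (pol R)).

(** The start of the k-th path on the cycle through [x]; that path ends at [iter k.+1 theta x],
    whose mate is the next knot. *)
Definition knot x k : V := mu (iter k theta x).

Lemma knot_period x : knot x n = knot x 0.
Proof. by rewrite /knot iter_turn. Qed.

Lemma pol_knot x k : p (knot x k) = ~~ p x.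
Proof. by rewrite /knot pol_mate pol_iter_turn. Qed.

Lemma strand_knot x k : cls (knot x k) = cls x.
Proof.
rewrite /knot strand_mate; elim: k => //= k <-.
by rewrite strand_twin strand_mate.
Qed.

Lemma knot_inj x k k' : k < n -> k' < n -> knot x k = knot x k' -> k = k'.
Proof.
move=> k_n k'_n /(can_inj (mateK R)) kk'.
rewrite -(@findex_iter _ theta x k) ?order_turn // kk'.
by rewrite findex_iter ?order_turn.
Qed.

(** All knots of a cycle have the same polarity, which excludes the reversed case of [trail_inj]. *)
Lemma trail_knot_inj x k r k' r' : k < n -> r < n -> k' < n -> r' < n ->
  trail R (knot x k) r = trail R (knot x k') r' -> k = k' /\ r = r'.
Proof.
move=> k_n r_n k'_n r'_n /trail_inj[] //; first by rewrite !strand_knot.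
  by move=> [/knot_inj -> // ->].
by move=> [/(congr1 p)]; rewrite pol_twin !pol_knot; case: (p x).
Qed.

Lemma step_knot x k r : step R (knot x k) r =
  if r.+1 == n then trail R (knot x k.+1) 0 else trail R (knot x k) r.+1.
Proof. by rewrite /step trail0. Qed.

Definition loop_verts x := [set trail R (knot x u.1) u.2 | u : 'I_n * 'I_n].
Definition loop_edges x := [set edge R (knot x u.1) u.2 | u : 'I_n * 'I_n].

Lemma mem_loop_verts x k r :
  k < n -> r < n -> trail R (knot x k) r \in loop_verts x.
Proof. by move=> k_n r_n; apply/imsetP; exists (Ordinal k_n, Ordinal r_n). Qed.

Lemma mem_loop_edges x k r :
  k < n -> r < n -> edge R (knot x k) r \in loop_edges x.
Proof. by move=> k_n r_n; apply/imsetP; exists (Ordinal k_n, Ordinal r_n). Qed.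

Lemma step_knot_mem x k r :
  k < n -> r < n -> step R (knot x k) r \in loop_verts x.
Proof.
move=> k_n r_n; rewrite step_knot; case: ifP => r1_n.
  case: (ltnP k.+1 n) => [k1_n|n_k1]; first by apply: mem_loop_verts; lia.
  have k1 : k.+1 = n by lia.
  by rewrite k1 knot_period; apply: mem_loop_verts; lia.
by apply: mem_loop_verts; lia.
Qed.

Fact loop_subproof x :
  [forall e in loop_edges x, (#|e| == 2) && (e \subset loop_verts x)].
Proof.
apply/forall_inP => _ /imsetP[[k r] _ ->] /=.
by rewrite card_edge // subUset !sub1set mem_loop_verts // step_knot_mem.
Qed.

Definition loop x : graph V := Graph (loop_subproof x).

(** The position is written in base n: the quotient counts paths, the remainder vertices on the
    path. *)
Definition walk x q : V := trail R (knot x (q %/ n)) (q %% n).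

Lemma walkE x k r : r < n -> walk x (k * n + r) = trail R (knot x k) r.
Proof.
move=> r_n; have n_gt0 : 0 < n by lia.
by rewrite /walk divnMDl // divn_small // addn0 modnMDl modn_small.
Qed.

Lemma walk_inj x : {in gtn (n * n) &, injective (walk x)}.
Proof.
move=> q q'; rewrite !inE => q_n q'_n; have n_gt0 : 0 < n by nia.
move=> /trail_knot_inj[]; rewrite ?ltn_divLR ?ltn_pmod // => dq mq.
by rewrite (divn_eq q n) dq mq -divn_eq.
Qed.

Lemma walk_step x q : q < n * n ->
  walk x (if q.+1 == n * n then 0 else q.+1)
    = step R (knot x (q %/ n)) (q %% n).
Proof.
move=> q_n; have n_gt0 : 0 < n by nia.
rewrite step_knot {1 2}(divn_eq q n).
have k_n : q %/ n < n by rewrite ltn_divLR.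
have r_n : q %% n < n by rewrite ltn_pmod.
move: (q %/ n) (q %% n) k_n r_n => k r k_n r_n.
case: ifP => [/eqP q1|q1]; case: ifP => [/eqP r1|r1].
- have k1 : k.+1 = n by nia.
  by rewrite k1 knot_period -(@walkE x 0 0).
- by nia.
- by rewrite -(@walkE x k.+1 0) //; congr walk; nia.
by rewrite -(@walkE x k r.+1); [congr walk; lia|lia].
Qed.

Lemma loop_is_cycle x : is_cycle (loop x).
Proof.
have n_gt1 := size_gt1 R x.
have walk_uniq : uniq (mkseq (walk x) (n * n)) by apply/mkseq_uniqP/walk_inj.
have qP u : u < n * n -> exists k r : 'I_n, u = k * n + r.
  move=> u_n; have k_n : u %/ n < n by rewrite ltn_divLR //; lia.
  have r_n : u %% n < n by rewrite ltn_pmod //; lia.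
  by exists (Ordinal k_n), (Ordinal r_n); rewrite -divn_eq.
have kr_n (k r : 'I_n) : k * n + r < n * n.
  by have := ltn_ord k; have := ltn_ord r; nia.
have mem_kr (k r : 'I_n) : k * n + r \in iota 0 (n * n).
  by rewrite mem_iota kr_n.
exists (mkseq (walk x) (n * n)); split=> //.
- by rewrite size_mkseq; nia.
- apply/setP => v; rewrite inE; apply/imsetP/mapP => [[[k r] _ ->]|[q]].
    by exists (k * n + r); rewrite ?mem_kr ?walkE.
  rewrite mem_iota => /qP[k [r ->]] ->.
  by exists (k, r); rewrite ?walkE.
have nextE (k r : 'I_n) : [set walk x (k * n + r);
     next (mkseq (walk x) (n * n)) (walk x (k * n + r))] = edge R (knot x k) r.
  rewrite next_mkseq // walk_step // walkE //.
  by rewrite divnMDl ?(ltnW n_gt1) // divn_small // addn0 modnMDl modn_small.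
apply/setP => e; apply/imsetP/imsetP => [[[k r] _ ->]|[v]].
  exists (walk x (k * n + r)); rewrite ?nextE //.
  by apply/mapP; exists (k * n + r); rewrite ?mem_kr.
move=> /mapP[q]; rewrite mem_iota => /qP[k [r ->]] -> ->.
by exists (k, r); rewrite ?nextE.
Qed.

(** * Cutting a cycle at its matching edges *)

Definition bead x k : {set V} := [set trail R (knot x k) r | r : 'I_n].
Definition bead_edges x k : {set {set V}} :=
  [set edge R (knot x k) r | r : 'I_n.-1].

Definition rung x k : {set V} := [set iter k theta x; mu (iter k theta x)].

(** The matching edge that follows the k-th path; rungs and paths are numbered with a cyclic shift
    by one. *)
Lemma rungS x k : rung x k.+1 = edge R (knot x k) n.-1.
Proof.
have n1 : n.-1.+1 == n by have := size_gt1 R x; lia.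
by rewrite /edge /step n1 trail_last.
Qed.

Definition rungs x : {set {set V}} := [set rung x k | k : 'I_n].

Lemma rungP x e : reflect (exists2 k, k < n & e = edge R (knot x k) n.-1)
                          (e \in rungs x).
Proof.
have n_gt1 := size_gt1 R x.
apply: (iffP imsetP) => [[k _ ->]|[k k_n ->]]; last first.
  case: (ltnP k.+1 n) => [k1_n|n_k1].
    by exists (Ordinal k1_n); rewrite ?rungS.
  have n0 : 0 < n by lia.
  exists (Ordinal n0) => //=; rewrite -rungS; have -> : k.+1 = n by lia.
  by rewrite /rung iter_turn.
case: k => [[|k] k_n] /=; last by exists k; rewrite ?rungS //; lia.
exists n.-1; first by lia.
by rewrite -rungS prednK ?(ltnW n_gt1) // /rung iter_turn.
Qed.

Hypothesis adj_deg : forall u, #|[set v | adj u v]| = n.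
Variable x : V.
Hypothesis px : ~~ p x.

Let edge_knot_inj k r k' r' : k < n -> k' < n -> r < n -> r' < n ->
  edge R (knot x k) r = edge R (knot x k') r' -> k = k' /\ r = r'.
Proof.
move=> k_n k'_n r_n r'_n /(edge_inj adj_deg); rewrite !pol_knot px.
by case=> // /knot_inj ->.
Qed.

Lemma card_loop_edges : #|loop_edges x| = n * n.
Proof.
rewrite card_imset ?card_prod ?card_ord // => -[k r] [k' r'] /=.
by move=> /edge_knot_inj[] // /val_inj -> /val_inj ->.
Qed.

Let pruned := delete_edges (loop x) (rungs x).

Lemma prunedP e :
  reflect (exists k r, [/\ k < n, r < n.-1 & e = edge R (knot x k) r])
          (e \in edges pruned).
Proof.
apply: (iffP setDP) => [[/imsetP[[k r] _ /= ->] e_rung]|[k [r [k_n r_n ->]]]].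
  exists k, r; split=> //; have := ltn_ord r.
  case: (ltngtP r n.-1) => //; try lia.
  by move=> rn _; case/rungP: e_rung; exists k; rewrite ?rn.
split; first by apply: mem_loop_edges; lia.
by apply/rungP => -[k' k'_n /edge_knot_inj[]]; lia.
Qed.

Let pruned_sym : connect_sym (adjacent pruned).
Proof. by apply: sym_connect_sym => u v; rewrite /adjacent setUC. Qed.

Lemma edge_sub_bead k r : r < n.-1 -> edge R (knot x k) r \subset bead x k.
Proof.
move=> r_n; rewrite subUset !sub1set step_knot ifN; last by lia.
have r0 : r < n by lia.
have r1 : r.+1 < n by lia.
rewrite (imset_f _ (_ : Ordinal r0 \in _)) //.
by rewrite (imset_f _ (_ : Ordinal r1 \in _)).
Qed.

Lemma mem_bead k k' r : k < n -> k' < n -> r < n ->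
  (trail R (knot x k') r \in bead x k) = (k' == k).
Proof.
move=> k_n k'_n r_n; apply/imsetP/eqP => [[s _ /trail_knot_inj[]]|->] //.
by exists (Ordinal r_n).
Qed.

(** Every remaining edge lies inside one bead, so beads are closed under adjacency; within a bead
    all vertices are joined to [knot x k]. *)
Lemma connect_bead k r : k < n -> r < n ->
  [set v in verts pruned | connect (adjacent pruned) (trail R (knot x k) r) v]
    = bead x k.
Proof.
move=> k_n r_n.
have bead_closed : closed (adjacent pruned) (bead x k).
  apply: (intro_closed pruned_sym) => u v /prunedP[k' [s [k'_n s_n uv]]] u_k.
  have u_uv : u \in edge R (knot x k') s by rewrite -uv set21.
  have v_uv : v \in edge R (knot x k') s by rewrite -uv set22.
  have := subsetP (edge_sub_bead k' s_n) _ u_uv.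
  case/imsetP=> t _ u_t; move: u_k; rewrite u_t mem_bead // => /eqP <-.
  exact: subsetP (edge_sub_bead k' s_n) _ v_uv.
have from0 s :
    s < n -> connect (adjacent pruned) (knot x k) (trail R (knot x k) s).
  elim: s => [|s IHs] s_n; first by rewrite trail0.
  apply: connect_trans (IHs (ltnW s_n)) (connect1 _).
  apply/prunedP; exists k, s; split=> //; first by lia.
  by rewrite /edge step_knot ltn_eqF.
apply/setP => v; rewrite inE; apply/andP/idP => [[_ v_k]|/imsetP[s _ ->]].
  by rewrite -(closed_connect bead_closed v_k) mem_bead.
split; first exact: mem_loop_verts.
by apply: connect_trans (from0 s _); rewrite // pruned_sym from0.
Qed.

Lemma components_pruned : components pruned = [set bead x k | k : 'I_n].
Proof.
apply/setP => A; apply/imsetP/imsetP => [[_ /imsetP[[k r] _ ->] ->]|[k _ ->]].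
  by exists k => //=; rewrite connect_bead.
(* Any position on the k-th path would serve; [k] itself is one in range. *)
by exists (trail R (knot x k) k); rewrite ?mem_loop_verts ?connect_bead.
Qed.

Lemma card_components_pruned : #|components pruned| = n.
Proof.
rewrite components_pruned card_imset ?card_ord // => k k' kk'.
apply/val_inj/eqP; rewrite /= -(@mem_bead k' k k) // -kk' mem_bead //.
Qed.

Lemma induced_bead_edges k : k < n ->
  edges (induced pruned (bead x k)) = bead_edges x k.
Proof.
move=> k_n; apply/setP => e; rewrite inE.
apply/andP/imsetP => [[/prunedP[k' [r [k'_n r_n ->]]] sub]|[r _ ->]].
  have : trail R (knot x k') r \in bead x k.
    by apply: (subsetP sub); apply: set21.
  rewrite mem_bead //; last by lia.
  by move=> /eqP kk'; exists (Ordinal r_n); rewrite // kk'.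
split; last exact: edge_sub_bead.
by apply/prunedP; exists k, r.
Qed.

Lemma induced_bead_is_path k : k < n -> is_path (induced pruned (bead x k)).
Proof.
move=> k_n; have n_gt1 := size_gt1 R x.
exists (mkseq (trail R (knot x k)) n); split.
- by rewrite size_mkseq; lia.
- by apply/mkseq_uniqP => r s /= r_n s_n /trail_knot_inj[].
- rewrite [verts _]/=; apply/setP => v; rewrite !inE.
  apply/andP/mapP => [[_ /imsetP[r _ ->]]|[r]].
    by exists (val r); rewrite // mem_iota /=.
  rewrite mem_iota => r_n ->; rewrite mem_bead // eqxx; split=> //.
  exact: mem_loop_verts.
rewrite induced_bead_edges // zip_behead_mkseq.
apply/setP => e; apply/imsetP/imsetP => [[r _ ->]|[[u v]]].
  exists (trail R (knot x k) r, trail R (knot x k) r.+1).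
    by apply/mapP; exists (val r); rewrite // mem_iota /=.
  by rewrite /edge step_knot ifN //; have := ltn_ord r; lia.
case/mapP=> r; rewrite mem_iota => /= r_n [-> ->] ->.
exists (Ordinal r_n) => //; rewrite /edge step_knot ifN //=; lia.
Qed.

Lemma card_bead_edges k : k < n -> #|bead_edges x k| = n.-1.
Proof.
move=> k_n; rewrite card_imset ?card_ord // => r s /= rs.
apply/val_inj; apply: proj2 (edge_knot_inj k_n k_n _ _ rs).
  by have := ltn_ord r; lia.
by have := ltn_ord s; lia.
Qed.

End Loops.

(** * Decomposition into cycles, and the perfect matching *)

Section LoopDecomposition.

Variables (V : finType) (adj : rel V) (n : nat) (R : routing adj n).
Hypothesis adj_irr : irreflexive adj.
Hypothesis adj_deg : forall u, #|[set v | adj u v]| = n.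

Local Notation mu := (mate R).
Local Notation theta := (twin R \o mate R).
Local Notation p := (pol R).
Local Notation cls := (strand (mate R) (twin R) (pol R)).

(** [mu] exchanges the two polarity classes. *)
Lemma card_pol : #|[pred x | ~~ p x]| * 2 = #|V|.
Proof.
have mu_p : mu @: [set x | p x] = ~: [set x | p x].
  apply/setP => x; rewrite !inE; apply/imsetP/idP => [[y]|px].
    by rewrite inE => py ->; rewrite pol_mate py.
  by exists (mu x); rewrite ?mateK // inE pol_mate.
rewrite -(cardsC [set x | p x]) -{1}(card_imset _ (can_inj (mateK R))) mu_p.
by rewrite addnn -muln2; congr (_ * 2); apply: eq_card => x; rewrite !inE.
Qed.

(** Take the roots of the [theta] orbits of negative polarity. These orbits have n elements each and
    cover half of the vertices, which fixes their number. *)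
Lemma knots_enum r : 0 < n -> r * n * 2 = #|V| ->
  exists x_ : 'I_r -> V,
    [/\ forall i, ~~ p (x_ i), forall i j, cls (x_ i) = cls (x_ j) -> i = j
      & forall y, ~~ p y -> exists i (k : 'I_n), y = iter k theta (x_ i)].
Proof.
move=> n_gt0 Vr; have theta_inj := @turn_inj _ _ _ R.
pose a := [pred x | ~~ p x]; pose S := [predI froots theta & a].
have a_closed : fclosed theta a.
  by move=> x _ /eqP <-; rewrite !inE; have := pol_iter_turn R 1 x => /= ->.
have S_r : r = #|S|.
  apply/eqP; rewrite -(eqn_pmul2r n_gt0) -(eqn_pmul2r (_ : 0 < 2)) // Vr.
  rewrite -card_pol.
  rewrite -(fcard_order_set theta_inj (n := n) _ a_closed) //.
  by apply/subsetP => x _; rewrite inE order_turn.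
have SP i : @enum_val _ (mem S) (cast_ord S_r i) \in S by apply: enum_valP.
exists (fun i => enum_val (cast_ord S_r i)); split.
- by move=> i; have /andP[] := SP i.
- move=> i j; have /andP[ri pi] := SP i; have /andP[rj pj] := SP j.
  rewrite /strand (negPf pi) (negPf pj) (eqP ri) (eqP rj).
  by move=> /enum_val_inj/cast_ord_inj.
move=> y py; have sym := fconnect_sym theta_inj.
have Sy : froot theta y \in S.
  apply/andP; split; first exact: roots_root.
  by rewrite -(closed_connect a_closed (connect_root _ y)).
exists (cast_ord (esym S_r) (enum_rank_in Sy (froot theta y))).
rewrite cast_ordKV enum_rankK_in //.
have y_root : fconnect theta (froot theta y) y by rewrite sym connect_root.
have lt_n : findex theta (froot theta y) y < n.
  by rewrite -[X in _ < X](order_turn R (froot theta y)) findex_max.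
by exists (Ordinal lt_n); rewrite /= iter_findex.
Qed.

Variable G : graph V.
Hypothesis G_verts : verts G = [set: V].
Hypothesis G_edges : edges G = [set [set u.1; u.2] | u : V * V & adj u.1 u.2].
Variables (r : nat) (x_ : 'I_r -> V).
Hypothesis x_pol : forall i, ~~ p (x_ i).
Hypothesis x_inj : forall i j, cls (x_ i) = cls (x_ j) -> i = j.
Hypothesis x_onto :
  forall y, ~~ p y -> exists i (k : 'I_n), y = iter k theta (x_ i).

Let C i := loop R adj_irr (x_ i).

(** By [edge_inj] a common edge starts from the same knot in both loops, so their strands agree. *)
Let loops_disjoint i j e : e \in edges (C i) -> e \in edges (C j) -> i = j.
Proof.
move=> /imsetP[[k s] _ ->] /imsetP[[k' s'] _ /= kk'].
apply: x_inj; rewrite -(strand_knot R (x_ i) k) -(strand_knot R (x_ j) k').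
congr strand; have [] := edge_inj adj_deg _ _ _ _ kk' => //.
  by rewrite pol_knot x_pol.
by rewrite pol_knot x_pol.
Qed.

Let loop_edge0 i : 0 < n -> edge R (knot R (x_ i) 0) 0 \in edges (C i).
Proof. by move=> n_gt0; apply: mem_loop_edges. Qed.

Lemma loops_decompose : cycle_decomposition G C.
Proof.
have n_gt0 (i : 'I_r) : 0 < n by have := size_gt1 R (x_ i); lia.
split; first by move=> i; apply: loop_is_cycle.
  move=> i j Cij; have e_i := loop_edge0 i (n_gt0 i).
  by apply: (loops_disjoint e_i); rewrite -[edges (C j)]Cij.
apply/and3P; split.
- apply/eqP/setP => e; apply/bigcupP/idP => [[_ /imsetP[i _ ->]]|].
    move=> /imsetP[[k s] _ ->]; rewrite G_edges; apply/imsetP.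
    exists (trail R (knot R (x_ i) k) s, step R (knot R (x_ i) k) s) => //.
    by rewrite inE; apply: step_adj.
  rewrite G_edges => /imsetP[[u v]]; rewrite inE => /(edge_onto R).
  move=> [z [s [pz s_n ->]]] ->.
  (* [mu z] is negative, hence an iterate of some [x_ i], which makes [z] a knot of that loop. *)
  have [|i [k zk]] := x_onto (y := mu z); first by rewrite pol_mate pz.
  exists (edges (C i)); first exact: imset_f.
  by rewrite -[z](mateK R) zk; apply: mem_loop_edges.
- apply/trivIsetP => _ _ /imsetP[i _ ->] /imsetP[j _ ->] Cij.
  rewrite -setI_eq0; apply/eqP/setP => e; rewrite !inE; apply/negP.
  by case/andP=> /loops_disjoint ij /ij ij'; rewrite ij' eqxx in Cij.
apply/imsetP => -[i _ C0].
by have := loop_edge0 i (n_gt0 i); rewrite -C0 inE.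
Qed.

(** Each matching edge has exactly one negative end, and every negative vertex is an iterate of some
    [x_ i]. *)
Lemma rungs_perfect_matching :
  perfect_matching G [set rung R (x_ i) j | i : 'I_r, j : 'I_n].
Proof.
have rung_edge y : [set y; mu y] \in edges G.
  by rewrite G_edges; apply/imsetP; exists (y, mu y); rewrite // inE adj_mate.
split.
- by apply/subsetP => _ /imset2P[i j _ _ ->]; apply: rung_edge.
- apply/trivIsetP => _ _ /imset2P[i j _ _ ->] /imset2P[i' j' _ _ ->].
  rewrite /rung; set u := iter j _ _; set v := iter j' _ _ => uv.
  have pu : ~~ p u by rewrite pol_iter_turn x_pol.
  have pv : ~~ p v by rewrite pol_iter_turn x_pol.
  rewrite -setI_eq0; apply/eqP/setP => w; rewrite !inE; apply/negP.
  case/andP=> /orP[]/eqP -> /orP[]/eqP e.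
  + by rewrite e eqxx in uv.
  + by rewrite e pol_mate pv in pu.
  + by rewrite -e pol_mate pu in pv.
  by rewrite (can_inj (mateK R) e) eqxx in uv.
rewrite G_verts; apply/setP => y; rewrite inE; apply/bigcupP.
case py: (p y).
  have [|i [k yk]] := x_onto (y := mu y); first by rewrite pol_mate py.
  exists (rung R (x_ i) k); first exact: imset2_f.
  by rewrite /rung -yk mateK set22.
have [|i [k yk]] := x_onto (y := y); first by rewrite py.
exists (rung R (x_ i) k); first exact: imset2_f.
by rewrite /rung -yk set21.
Qed.

Lemma loop_rungs i :
  [/\ injective (fun j : 'I_n => rung R (x_ i) j),
      forall j : 'I_n, rung R (x_ i) j \in edges (C i),
      #|components (delete_edges (C i) (rungs R (x_ i)))| = n
    & forall A, A \in components (delete_edges (C i) (rungs R (x_ i))) ->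
        let P := induced (delete_edges (C i) (rungs R (x_ i))) A in
        is_path P /\ glength P = n - 1].
Proof.
have px := x_pol i; split.
- move=> j k /set2_eq[[]|[]] jk _.
    have jk' : knot R (x_ i) j = knot R (x_ i) k by rewrite /knot jk.
    exact/val_inj/(knot_inj (ltn_ord j) (ltn_ord k) jk').
  have := pol_iter_turn R j (x_ i).
  by rewrite jk pol_mate pol_iter_turn; case: (p _).
- move=> j; have /rungP[k k_n ->] : rung R (x_ i) j \in rungs R (x_ i).
    exact: imset_f.
  by apply: mem_loop_edges; lia.
- exact: card_components_pruned.
move=> A; rewrite components_pruned // => /imsetP[k _ ->]; split.
  exact: induced_bead_is_path.
by rewrite /glength induced_bead_edges // card_bead_edges // subn1.
Qed.

End LoopDecomposition.

(** * Regularity of the hypercube, and the conclusion *)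

Lemma cube_adj_irr n : irreflexive (@cube_adj n).
Proof.
by move=> x; rewrite cube_adjE big1 // => i _; rewrite eqxx.
Qed.

(** Flipping one coordinate gives a bijection from coordinates to neighbors. *)
Lemma cube_adj_deg n (x : n.-tuple bool) : #|[set y | cube_adj x y]| = n.
Proof.
pose flip i := [tuple (j == i) (+) tnth x j | j < n].
have flip_diff i : [set j | tnth x j != tnth (flip i) j] = [set i].
  apply/setP => j; rewrite !inE tnth_mktuple.
  by case: (j == i) (tnth x j) => [] [].
have flip_inj : injective flip.
  by move=> i j ij; apply/set1P; rewrite -flip_diff -ij flip_diff set11.
rewrite -[RHS]card_ord -(card_imset _ flip_inj); apply: eq_card => y.
rewrite inE; apply/cards1P/imsetP => [[i xy]|[i _ ->]]; last by exists i.
exists i => //; apply: eq_from_tnth => j; rewrite tnth_mktuple.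
have := in_set1 j i; rewrite -xy inE => <-.
by case: (tnth x j) (tnth y j) => [] [].
Qed.

Theorem theorem3p1 (m n : nat) (hm : 1 <= m) (hn : n = 2 ^ m) :
  exists (C : 'I_(2 ^ (n - 1 - m)) -> graph (n.-tuple bool))
         (e : 'I_(2 ^ (n - 1 - m)) -> 'I_(2 ^ m) -> {set n.-tuple bool}),
    [/\ cycle_decomposition (hypercube n) C,
        forall i, glength (C i) = 2 ^ m * n,
        forall i,
          [/\ injective (e i),
              forall j, e i j \in edges (C i),
              #|components (delete_edges (C i) [set e i j | j : 'I_(2 ^ m)])|
                = 2 ^ m
            & forall A : {set n.-tuple bool},
                A \in components
                        (delete_edges (C i) [set e i j | j : 'I_(2 ^ m)]) ->
                let P := induced
                  (delete_edges (C i) [set e i j | j : 'I_(2 ^ m)]) A in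
                is_path P /\ glength P = n - 1]
      & perfect_matching (hypercube n)
          [set e i j | i : 'I_(2 ^ (n - 1 - m)), j : 'I_(2 ^ m)]].
Proof.
case: m hm hn => // m _ hn; have [R] := cube_routing m; subst n.
set n := 2 ^ m.+1 in R *.
have cardV : 2 ^ (n - 1 - m.+1) * n * 2 = #|{: n.-tuple bool}|.
  rewrite card_tuple card_bool {2}/n -expnD -expnSr; congr (2 ^ _).
  (* This keeps the subtraction in the exponent from being truncated. *)
  have : m.+1 < n by apply: ltn_expl.
  by lia.
have n_gt0 : 0 < n by rewrite expn_gt0.
have [x_ [x_pol x_inj x_onto]] := knots_enum R n_gt0 cardV.
have irr := @cube_adj_irr n; have deg := @cube_adj_deg n.
exists (fun i => loop R irr (x_ i)), (fun i j => rung R (x_ i) j).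
split.
- exact: loops_decompose.
- by move=> i; apply: card_loop_edges.
- by move=> i; apply: loop_rungs.
exact: rungs_perfect_matching.
Qed.
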